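(* (Catalan identity for $\mathbf{Q}W_n(s)$.) Let $n\geq 0$, $m\geq 0$ be integers such that $n\geq m$. Then $$\left[\mathbf{Q}W_{n}(s)\right]^{2}-\mathbf{Q}W_{n-m}(s)\,\mathbf{Q}W_{n+m}(s)=\frac{AB(\alpha\beta)^{s(n-m)}\left(\alpha^{sm}-\beta^{sm}\right)}{\left[A\alpha^{s}-B\beta^{s}\right]^{2}}\Big\{\left(\alpha^{sm}-\beta^{sm}\right)\Theta_{\alpha}(s)\Theta_{\beta}(s)+\alpha^{sm}\left[\Theta_{\beta}(s),\Theta_{\alpha}(s)\right]\Big\},$$ where $\left[\Theta_{\beta}(s),\Theta_{\alpha}(s)\right]=2(\alpha\beta)^{s}(\alpha^{s}-\beta^{s})\left[\lambda_{3}(\alpha\beta)^{s}\mathbf{i}-\lambda_{2}(\alpha^{s}+\beta^{s})\mathbf{j}+\lambda_{1}\mathbf{k}\right]$.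
   Context: Let $\alpha,\beta$ be distinct nonzero real numbers, $W_0,W_1$ real numbers, $A=W_1-W_0\beta$, $B=W_1-W_0\alpha$, and let $W_n=\frac{A\alpha^n-B\beta^n}{\alpha-\beta}$ ($n\geq 0$) be the Horadam numbers. Fix an integer $s\geq 1$ with $W_s\neq 0$, equivalently $A\alpha^s-B\beta^s\neq 0$. The higher order Horadam numbers are $W_n(s)=\frac{W_{sn}}{W_s}=\frac{A\alpha^{sn}-B\beta^{sn}}{A\alpha^s-B\beta^s}$, $n\geq 0$. Let $\lambda_1,\lambda_2,\lambda_3$ be real parameters. The 3-parameter generalized quaternions form the real algebra of elements $x_0\mathbf{1}+x_1\mathbf{i}+x_2\mathbf{j}+x_3\mathbf{k}$ ($x_r\in\mathbb{R}$) with basis $\mathbf{1},\mathbf{i},\mathbf{j},\mathbf{k}$ and bilinear multiplication in which $\mathbf{1}$ is the identity and $\mathbf{i}^2=-\lambda_1\lambda_2\mathbf{1}$, $\mathbf{j}^2=-\lambda_1\lambda_3\mathbf{1}$, $\mathbf{k}^2=-\lambda_2\lambda_3\mathbf{1}$, $\mathbf{i}\mathbf{j}=\lambda_1\mathbf{k}=-\mathbf{j}\mathbf{i}$, $\mathbf{j}\mathbf{k}=\lambda_3\mathbf{i}=-\mathbf{k}\mathbf{j}$, $\mathbf{k}\mathbf{i}=\lambda_2\mathbf{j}=-\mathbf{i}\mathbf{k}$. The higher order Horadam 3-parameter generalized quaternions are $\mathbf{Q}W_n(s)=W_n(s)\mathbf{1}+W_{n+1}(s)\mathbf{i}+W_{n+2}(s)\mathbf{j}+W_{n+3}(s)\mathbf{k}$,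 $n\geq 0$. Put $\Theta_{\alpha}(s)=\mathbf{1}+\alpha^{s}\mathbf{i}+\alpha^{2s}\mathbf{j}+\alpha^{3s}\mathbf{k}$ and $\Theta_{\beta}(s)=\mathbf{1}+\beta^{s}\mathbf{i}+\beta^{2s}\mathbf{j}+\beta^{3s}\mathbf{k}$; the bracket $[\Theta_\beta(s),\Theta_\alpha(s)]$ denotes the commutator $\Theta_\beta(s)\Theta_\alpha(s)-\Theta_\alpha(s)\Theta_\beta(s)$. *)

(* Defs.v *)
From HB Require Import structures.
From mathcomp Require Import all_boot all_order all_algebra.
From mathcomp Require Import reals ring.

Set Implicit Arguments.
Unset Strict Implicit.
Unset Printing Implicit Defensive.

Import GRing.Theory.
Local Open Scope ring_scope.

(* The parameters l1, l2, l3 are phantom in the carrier: they only select the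
   multiplication. *)
Record g3quat (R : realType) (l1 l2 l3 : R) := G3Quat {
  q3re : R; q3i : R; q3j : R; q3k : R }.

Definition g3quat_pack (R : realType) (l1 l2 l3 : R) (x : g3quat l1 l2 l3) :=
  (q3re x, q3i x, q3j x, q3k x).

Definition g3quat_unpack (R : realType) (l1 l2 l3 : R) (t : R * R * R * R) :
    g3quat l1 l2 l3 :=
  G3Quat l1 l2 l3 t.1.1.1 t.1.1.2 t.1.2 t.2.

Lemma g3quat_packK (R : realType) (l1 l2 l3 : R) :
  cancel (@g3quat_pack R l1 l2 l3) (@g3quat_unpack R l1 l2 l3).
Proof. by case. Qed.

HB.instance Definition _ (R : realType) (l1 l2 l3 : R) :=
  Choice.copy (g3quat l1 l2 l3) (can_type (@g3quat_packK R l1 l2 l3)).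

Lemma g3quat_eq (R : realType) (l1 l2 l3 : R) (x y : g3quat l1 l2 l3) :
  q3re x = q3re y -> q3i x = q3i y -> q3j x = q3j y -> q3k x = q3k y -> x = y.
Proof. by case: x y => [? ? ? ?] [? ? ? ?] /= -> -> -> ->. Qed.

Definition g3quat_zero (R : realType) (l1 l2 l3 : R) : g3quat l1 l2 l3 :=
  G3Quat l1 l2 l3 0 0 0 0.

Definition g3quat_opp (R : realType) (l1 l2 l3 : R) (x : g3quat l1 l2 l3) :=
  G3Quat l1 l2 l3 (- q3re x) (- q3i x) (- q3j x) (- q3k x).

Definition g3quat_add (R : realType) (l1 l2 l3 : R) (x y : g3quat l1 l2 l3) :=
  G3Quat l1 l2 l3 (q3re x + q3re y) (q3i x + q3i y)
    (q3j x + q3j y) (q3k x + q3k y).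

Definition g3quat_scale (R : realType) (l1 l2 l3 : R) (a : R)
    (x : g3quat l1 l2 l3) :=
  G3Quat l1 l2 l3 (a * q3re x) (a * q3i x) (a * q3j x) (a * q3k x).

Definition g3quat_one (R : realType) (l1 l2 l3 : R) : g3quat l1 l2 l3 :=
  G3Quat l1 l2 l3 1 0 0 0.

(* Bilinear extension of the multiplication table of 1, i, j, k; the table
   itself is recovered in the lemmas g3quat_ii, ..., g3quat_ik below. *)
Definition g3quat_mul (R : realType) (l1 l2 l3 : R) (x y : g3quat l1 l2 l3) :=
  G3Quat l1 l2 l3
    (q3re x * q3re y - l1 * l2 * (q3i x * q3i y)
       - l1 * l3 * (q3j x * q3j y) - l2 * l3 * (q3k x * q3k y))
    (q3re x * q3i y + q3i x * q3re y + l3 * (q3j x * q3k y - q3k x * q3j y))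
    (q3re x * q3j y + q3j x * q3re y + l2 * (q3k x * q3i y - q3i x * q3k y))
    (q3re x * q3k y + q3k x * q3re y + l1 * (q3i x * q3j y - q3j x * q3i y)).

Lemma g3quat_addA (R : realType) (l1 l2 l3 : R) :
  associative (@g3quat_add R l1 l2 l3).
Proof. by move=> x y z; apply: g3quat_eq => /=; ring. Qed.

Lemma g3quat_addC (R : realType) (l1 l2 l3 : R) :
  commutative (@g3quat_add R l1 l2 l3).
Proof. by move=> x y; apply: g3quat_eq => /=; ring. Qed.

Lemma g3quat_add0 (R : realType) (l1 l2 l3 : R) :
  left_id (@g3quat_zero R l1 l2 l3) (@g3quat_add R l1 l2 l3).
Proof. by move=> x; apply: g3quat_eq => /=; ring. Qed.

Lemma g3quat_addN (R : realType) (l1 l2 l3 : R) :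
  left_inverse (@g3quat_zero R l1 l2 l3) (@g3quat_opp R l1 l2 l3)
    (@g3quat_add R l1 l2 l3).
Proof. by move=> x; apply: g3quat_eq => /=; ring. Qed.

HB.instance Definition _ (R : realType) (l1 l2 l3 : R) :=
  GRing.isZmodule.Build (g3quat l1 l2 l3) (@g3quat_addA R l1 l2 l3)
    (@g3quat_addC R l1 l2 l3) (@g3quat_add0 R l1 l2 l3)
    (@g3quat_addN R l1 l2 l3).

Lemma g3quat_mulA (R : realType) (l1 l2 l3 : R) :
  associative (@g3quat_mul R l1 l2 l3).
Proof. by move=> x y z; apply: g3quat_eq => /=; ring. Qed.

Lemma g3quat_mul1l (R : realType) (l1 l2 l3 : R) :
  left_id (@g3quat_one R l1 l2 l3) (@g3quat_mul R l1 l2 l3).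
Proof. by move=> x; apply: g3quat_eq => /=; ring. Qed.

Lemma g3quat_mul1r (R : realType) (l1 l2 l3 : R) :
  right_id (@g3quat_one R l1 l2 l3) (@g3quat_mul R l1 l2 l3).
Proof. by move=> x; apply: g3quat_eq => /=; ring. Qed.

Lemma g3quat_mulDl (R : realType) (l1 l2 l3 : R) :
  left_distributive (@g3quat_mul R l1 l2 l3) +%R.
Proof. by move=> x y z; apply: g3quat_eq => /=; ring. Qed.

Lemma g3quat_mulDr (R : realType) (l1 l2 l3 : R) :
  right_distributive (@g3quat_mul R l1 l2 l3) +%R.
Proof. by move=> x y z; apply: g3quat_eq => /=; ring. Qed.

Lemma g3quat_one_neq0 (R : realType) (l1 l2 l3 : R) :
  @g3quat_one R l1 l2 l3 != 0.
Proof. by apply/eqP => -[] /eqP; rewrite oner_eq0. Qed.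

HB.instance Definition _ (R : realType) (l1 l2 l3 : R) :=
  GRing.Zmodule_isNzRing.Build (g3quat l1 l2 l3) (@g3quat_mulA R l1 l2 l3)
    (@g3quat_mul1l R l1 l2 l3) (@g3quat_mul1r R l1 l2 l3)
    (@g3quat_mulDl R l1 l2 l3) (@g3quat_mulDr R l1 l2 l3)
    (@g3quat_one_neq0 R l1 l2 l3).

Lemma g3quat_scaleA (R : realType) (l1 l2 l3 a b : R) (x : g3quat l1 l2 l3) :
  g3quat_scale a (g3quat_scale b x) = g3quat_scale (a * b) x.
Proof. by apply: g3quat_eq => /=; ring. Qed.

Lemma g3quat_scale1 (R : realType) (l1 l2 l3 : R) :
  left_id 1 (@g3quat_scale R l1 l2 l3).
Proof. by move=> x; apply: g3quat_eq => /=; ring. Qed.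

Lemma g3quat_scaleDr (R : realType) (l1 l2 l3 : R) :
  right_distributive (@g3quat_scale R l1 l2 l3) +%R.
Proof. by move=> a x y; apply: g3quat_eq => /=; ring. Qed.

Lemma g3quat_scaleDl (R : realType) (l1 l2 l3 : R) (x : g3quat l1 l2 l3) :
  {morph (@g3quat_scale R l1 l2 l3)^~ x : a b / a + b}.
Proof. by move=> a b; apply: g3quat_eq => /=; ring. Qed.

HB.instance Definition _ (R : realType) (l1 l2 l3 : R) :=
  GRing.Zmodule_isLmodule.Build R (g3quat l1 l2 l3)
    (@g3quat_scaleA R l1 l2 l3) (@g3quat_scale1 R l1 l2 l3)
    (@g3quat_scaleDr R l1 l2 l3) (@g3quat_scaleDl R l1 l2 l3).

Lemma g3quat_scaleAl (R : realType) (l1 l2 l3 a : R) (x y : g3quat l1 l2 l3) :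
  a *: (x * y) = a *: x * y.
Proof. by apply: g3quat_eq => /=; ring. Qed.

Lemma g3quat_scaleAr (R : realType) (l1 l2 l3 a : R) (x y : g3quat l1 l2 l3) :
  a *: (x * y) = x * (a *: y).
Proof. by apply: g3quat_eq => /=; ring. Qed.

HB.instance Definition _ (R : realType) (l1 l2 l3 : R) :=
  GRing.Lmodule_isLalgebra.Build R (g3quat l1 l2 l3)
    (@g3quat_scaleAl R l1 l2 l3).

HB.instance Definition _ (R : realType) (l1 l2 l3 : R) :=
  GRing.Lalgebra_isAlgebra.Build R (g3quat l1 l2 l3)
    (@g3quat_scaleAr R l1 l2 l3).

Definition g3i (R : realType) (l1 l2 l3 : R) : g3quat l1 l2 l3 :=
  G3Quat l1 l2 l3 0 1 0 0.
Definition g3j (R : realType) (l1 l2 l3 : R) : g3quat l1 l2 l3 :=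
  G3Quat l1 l2 l3 0 0 1 0.
Definition g3k (R : realType) (l1 l2 l3 : R) : g3quat l1 l2 l3 :=
  G3Quat l1 l2 l3 0 0 0 1.

Lemma g3quat_basis (R : realType) (l1 l2 l3 : R) (x : g3quat l1 l2 l3) :
  x = q3re x *: 1 + q3i x *: g3i l1 l2 l3 + q3j x *: g3j l1 l2 l3
        + q3k x *: g3k l1 l2 l3.
Proof. by apply: g3quat_eq => /=; ring. Qed.

Lemma g3quat_ii (R : realType) (l1 l2 l3 : R) :
  g3i l1 l2 l3 * g3i l1 l2 l3 = - (l1 * l2) *: 1.
Proof. by apply: g3quat_eq => /=; ring. Qed.

Lemma g3quat_jj (R : realType) (l1 l2 l3 : R) :
  g3j l1 l2 l3 * g3j l1 l2 l3 = - (l1 * l3) *: 1.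
Proof. by apply: g3quat_eq => /=; ring. Qed.

Lemma g3quat_kk (R : realType) (l1 l2 l3 : R) :
  g3k l1 l2 l3 * g3k l1 l2 l3 = - (l2 * l3) *: 1.
Proof. by apply: g3quat_eq => /=; ring. Qed.

Lemma g3quat_ij (R : realType) (l1 l2 l3 : R) :
  g3i l1 l2 l3 * g3j l1 l2 l3 = l1 *: g3k l1 l2 l3.
Proof. by apply: g3quat_eq => /=; ring. Qed.

Lemma g3quat_ji (R : realType) (l1 l2 l3 : R) :
  g3j l1 l2 l3 * g3i l1 l2 l3 = - (l1 *: g3k l1 l2 l3).
Proof. by apply: g3quat_eq => /=; ring. Qed.

Lemma g3quat_jk (R : realType) (l1 l2 l3 : R) :
  g3j l1 l2 l3 * g3k l1 l2 l3 = l3 *: g3i l1 l2 l3.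
Proof. by apply: g3quat_eq => /=; ring. Qed.

Lemma g3quat_kj (R : realType) (l1 l2 l3 : R) :
  g3k l1 l2 l3 * g3j l1 l2 l3 = - (l3 *: g3i l1 l2 l3).
Proof. by apply: g3quat_eq => /=; ring. Qed.

Lemma g3quat_ki (R : realType) (l1 l2 l3 : R) :
  g3k l1 l2 l3 * g3i l1 l2 l3 = l2 *: g3j l1 l2 l3.
Proof. by apply: g3quat_eq => /=; ring. Qed.

Lemma g3quat_ik (R : realType) (l1 l2 l3 : R) :
  g3i l1 l2 l3 * g3k l1 l2 l3 = - (l2 *: g3j l1 l2 l3).
Proof. by apply: g3quat_eq => /=; ring. Qed.

Definition horadamA (R : realType) (beta W0 W1 : R) : R := W1 - W0 * beta.

Definition horadamB (R : realType) (alpha W0 W1 : R) : R := W1 - W0 * alpha.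

Definition horadam (R : realType) (alpha beta W0 W1 : R) (n : nat) : R :=
  (horadamA beta W0 W1 * alpha ^+ n - horadamB alpha W0 W1 * beta ^+ n)
    / (alpha - beta).

Definition hohoradam (R : realType) (alpha beta W0 W1 : R) (s n : nat) : R :=
  horadam alpha beta W0 W1 (s * n)%N / horadam alpha beta W0 W1 s.

Definition QW (R : realType) (l1 l2 l3 alpha beta W0 W1 : R) (s n : nat) :
    g3quat l1 l2 l3 :=
  hohoradam alpha beta W0 W1 s n *: 1
  + hohoradam alpha beta W0 W1 s n.+1 *: g3i l1 l2 l3
  + hohoradam alpha beta W0 W1 s n.+2 *: g3j l1 l2 l3
  + hohoradam alpha beta W0 W1 s n.+3 *: g3k l1 l2 l3.

Definition Theta (R : realType) (l1 l2 l3 x : R) (s : nat) : g3quat l1 l2 l3 :=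
  1 + x ^+ s *: g3i l1 l2 l3 + x ^+ (2 * s) *: g3j l1 l2 l3
    + x ^+ (3 * s) *: g3k l1 l2 l3.

(* The ring commutator; the group commutator [~ x, y] of the library is a
   different operation. *)
Definition ring_commutator (A : pzRingType) (x y : A) : A := x * y - y * x.

(* Main.v *)
(* Binet's formula QW_n = (A alpha^(sn) Theta_alpha - B beta^(sn) Theta_beta) / D,
   with D = A alpha^s - B beta^s, reduces the identity to noncommutative algebra:
   with u = alpha^(sm) and v = beta^(sm), the Theta_alpha^2 and Theta_beta^2 terms
   cancel and the mixed ones leave
   A B (alpha beta)^(s(n-m)) (u - v) (u Theta_beta Theta_alpha - v Theta_alpha Theta_beta) / D^2. *)
Require Import Defs.
From mathcomp Require Import all_boot all_order all_algebra.
From mathcomp Require Import reals ring.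

Set Implicit Arguments.
Unset Strict Implicit.
Unset Printing Implicit Defensive.

Import GRing.Theory.
Local Open Scope ring_scope.

Lemma QW_binet (R : realType) (l1 l2 l3 alpha beta W0 W1 : R) (s n : nat) :
  alpha != beta -> horadam alpha beta W0 W1 s != 0 ->
  let A := horadamA beta W0 W1 in
  let B := horadamB alpha W0 W1 in
  QW l1 l2 l3 alpha beta W0 W1 s n =
    (A * alpha ^+ s - B * beta ^+ s)^-1 *:
      ((A * alpha ^+ (s * n)) *: Theta l1 l2 l3 alpha s
       - (B * beta ^+ (s * n)) *: Theta l1 l2 l3 beta s).
Proof.
rewrite -subr_eq0 /QW /Theta /hohoradam /horadam => ab_neq0.
(* [W_s] is the quotient of D by [alpha - beta], so [W_s != 0] forces D to be nonzero. *)
rewrite mulf_eq0 negb_or => /andP[D_neq0 _] /=.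
rewrite !mulnS !(mulnC _ s) !mulnS !muln0 !addn0 !exprD.
by apply: g3quat_eq => /=; field; rewrite ab_neq0 D_neq0.
Qed.

(** Here [p], [q] stand for the powers of exponent s(n-m). The mixed terms take the commutator form
    through u yx - v xy = (u - v) xy + u (yx - xy). *)
Lemma g3quat_catalan (R : realType) (l1 l2 l3 a b p q u v : R)
    (x y : g3quat l1 l2 l3) :
  ((a * (p * u)) *: x - (b * (q * v)) *: y) ^+ 2
    - ((a * p) *: x - (b * q) *: y)
      * ((a * (p * u * u)) *: x - (b * (q * v * v)) *: y)
  = (a * b * (p * q) * (u - v)) *:
      ((u - v) *: (x * y) + u *: ring_commutator y x).
Proof. by apply: g3quat_eq => /=; ring. Qed.

(** With X = x^s and Y = y^s, only twice the 2x2 minors of (X, X^2, X^3) and (Y, Y^2, Y^3) survive;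
    each is divisible by XY(X - Y). *)
Lemma Theta_commutator (R : realType) (l1 l2 l3 x y : R) (s : nat) :
  ring_commutator (Theta l1 l2 l3 y s) (Theta l1 l2 l3 x s)
    = (2 * (x * y) ^+ s * (x ^+ s - y ^+ s))
      *: ((l3 * (x * y) ^+ s) *: g3i l1 l2 l3
          - (l2 * (x ^+ s + y ^+ s)) *: g3j l1 l2 l3
          + l1 *: g3k l1 l2 l3).
Proof.
rewrite /Theta !(mulnC _ s) !mulnS !muln0 !addn0 !exprD exprMn.
by apply: g3quat_eq => /=; ring.
Qed.

Theorem theorem3p1 (R : realType) (l1 l2 l3 alpha beta W0 W1 : R) (s n m : nat)
    (alpha_neq0 : alpha != 0) (beta_neq0 : beta != 0)
    (alpha_neq_beta : alpha != beta)
    (s_ge1 : (1 <= s)%N) (Ws_neq0 : horadam alpha beta W0 W1 s != 0)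
    (le_mn : (m <= n)%N) :
  let A := horadamA beta W0 W1 in
  let B := horadamB alpha W0 W1 in
  let Q := QW l1 l2 l3 alpha beta W0 W1 s in
  let Ta := Theta l1 l2 l3 alpha s in
  let Tb := Theta l1 l2 l3 beta s in
  Q n ^+ 2 - Q (n - m)%N * Q (n + m)%N
    = (A * B * (alpha * beta) ^+ (s * (n - m))
         * (alpha ^+ (s * m) - beta ^+ (s * m))
         / (A * alpha ^+ s - B * beta ^+ s) ^+ 2)
      *: ((alpha ^+ (s * m) - beta ^+ (s * m)) *: (Ta * Tb)
          + alpha ^+ (s * m) *: ring_commutator Tb Ta)
  /\ ring_commutator Tb Ta
    = (2 * (alpha * beta) ^+ s * (alpha ^+ s - beta ^+ s))
      *: ((l3 * (alpha * beta) ^+ s) *: g3i l1 l2 l3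
          - (l2 * (alpha ^+ s + beta ^+ s)) *: g3j l1 l2 l3
          + l1 *: g3k l1 l2 l3).
Proof.
move=> A B Q Ta Tb; split; last exact: Theta_commutator.
rewrite /Q !QW_binet // -/A -/B -/Ta -/Tb.
set D := A * _ - _.
(* [m <= n] makes [n - m] a true difference, so all three indices reduce to the powers in
   [g3quat_catalan]. *)
have En (x : R) : x ^+ (s * n) = x ^+ (s * (n - m)) * x ^+ (s * m).
  by rewrite -exprD -mulnDr subnK.
rewrite mulnDr !exprD !En exprZn -scalerAl -scalerAr scalerA -expr2 -scalerBr.
by rewrite g3quat_catalan scalerA exprMn exprVn mulrC.
Qed.
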